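(* When $\alpha \ge 5$, there is a polynomial-time $O(\sqrt{n}\log n)$-approximation algorithm for the 1-DR-$\alpha$ problem, where $n$ is the number of vertices of the input graph.
   Context: For a graph $G=(V,E)$ and $S\subseteq V$, $G[S]$ is the subgraph induced by $S$. For vertices $u,v$, $m_G(u,v)$ is the number of internal vertices on a shortest $u$–$v$ path in $G$ (so $m_G(u,v)=0$ if $u,v$ are adjacent, and $m_G(u,v)=1$ if they are non-adjacent but have a common neighbor); it is $\infty$ if no path exists. For $D\subseteq V$, $m^D_G(u,v)=m_{G[D\cup\{u,v\}]}(u,v)$. Two vertices $u,v$ form a target couple $[u,v]$ if $m_G(u,v)=1$. A set $D$ covers a target couple $[u,v]$ if $m^D_G(u,v)\le\alpha$. A set $D$ is a dominating set if every vertex of $V\setminus D$ is adjacent to a vertex of $D$. The 1-DR-$\alpha$ problem ($\alpha$ a positive integer): given a connected graph $G$, find a minimum-cardinality dominating set $D$ of $G$ that covers every target couple of $G$. An $r$-approximation algorithm outputs a feasible solution of size at most $r$ times the optimum. *)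

(* Defs.v *)
From mathcomp Require Import all_boot all_order all_algebra.

Set Implicit Arguments.
Unset Strict Implicit.
Unset Printing Implicit Defensive.

Import Order.TTheory GRing.Theory Num.Theory.

Record sgraph (T : finType) := SGraph {
  edge :> rel T;
  edge_sym : symmetric edge;
  edge_irr : irreflexive edge }.

Section Graphs.
Variable T : finType.
Implicit Types (G : sgraph T) (u v w : T) (S D : {set T}) (alpha : nat).

Definition connected G : Prop := 0 < #|T| /\ forall u v, connect G u v.

(* [u :: p] is a path (without repeated vertices) from [u] to [v]; it has
   [size p] edges, hence [(size p).-1] internal vertices. *)
Definition is_path G u v (p : seq T) : bool :=
  [&& path G u p, last u p == v & uniq (u :: p)].

(* Length of a shortest path. A path has fewer than #|T| edges, so the search
   fails, returning #|T|, exactly when there is no path from [u] to [v]. *)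
Definition dist G u v : nat :=
  find (fun k => [exists p : k.-tuple T, is_path G u v p]) (iota 0 #|T|).

(* m_G(u,v), where [None] stands for infinity. *)
Definition internal G u v : option nat :=
  if dist G u v < #|T| then Some (dist G u v).-1 else None.

Definition induced_edge G S : rel {x | x \in S} := fun x y => G (val x) (val y).

Lemma induced_sym G S : symmetric (@induced_edge G S).
Proof. by move=> x y; rewrite /induced_edge edge_sym. Qed.

Lemma induced_irr G S : irreflexive (@induced_edge G S).
Proof. by move=> x; rewrite /induced_edge edge_irr. Qed.

Definition induced G S : sgraph {x | x \in S} :=
  SGraph (@induced_sym G S) (@induced_irr G S).

End Graphs.

Section Problem.
Variable T : finType.
Implicit Types (G : sgraph T) (u v w : T) (S D : {set T}) (alpha : nat).

Lemma in_endl D u v : u \in D :|: [set u; v].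
Proof. by rewrite !inE eqxx orbT. Qed.

Lemma in_endr D u v : v \in D :|: [set u; v].
Proof. by rewrite !inE eqxx !orbT. Qed.

(* m^D_G(u,v) *)
Definition internal_via G D u v : option nat :=
  internal (induced G (D :|: [set u; v]))
    (exist _ u (in_endl D u v)) (exist _ v (in_endr D u v)).

Definition target_couple G u v : bool := internal G u v == Some 1.

Definition covers G alpha D u v : bool :=
  if internal_via G D u v is Some k then k <= alpha else false.

Definition dominating G D : bool :=
  [forall u, (u \notin D) ==> [exists v in D, G u v]].

Definition feasible G alpha D : bool :=
  dominating G D &&
  [forall u, forall v, target_couple G u v ==> covers G alpha D u v].

(* The full vertex set is feasible as soon as alpha is positive. *)
Definition optimum G alpha : nat :=
  #|[arg min_(D < [set: T] | feasible G alpha D) #|D|]|.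

End Problem.

(* The random access machine of Cook and Reckhow (Time bounded random access
   machines, 1973), over natural numbers with truncated subtraction. Registers
   grow by at most one bit per instruction, so that polynomial time with unit
   cost agrees with polynomial time on Turing machines. *)
Inductive instr :=
| IConst of nat & nat           (* X_i <- c                  *)
| IAdd of nat & nat & nat       (* X_i <- X_j + X_k          *)
| ISub of nat & nat & nat       (* X_i <- X_j - X_k          *)
| ILoad of nat & nat            (* X_i <- X_(X_j)            *)
| IStore of nat & nat           (* X_(X_i) <- X_j            *)
| IJump of nat & nat            (* go to line l if X_j > 0   *)
| IRead of nat                  (* X_i <- next input number  *)
| IPrint of nat.                (* append X_i to the output  *)

Definition program := seq instr.

Record state := State {
  pc : nat;
  reg : nat -> nat;
  input : seq nat;
  output : seq nat }.

Definition upd (X : nat -> nat) (i a : nat) : nat -> nat :=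
  fun j => if j == i then a else X j.

Definition exec (c : instr) (s : state) : state :=
  let: State l X x y := s in
  match c with
  | IConst i a => State l.+1 (upd X i a) x y
  | IAdd i j k => State l.+1 (upd X i (X j + X k)) x y
  | ISub i j k => State l.+1 (upd X i (X j - X k)) x y
  | ILoad i j => State l.+1 (upd X i (X (X j))) x y
  | IStore i j => State l.+1 (upd X (X i) (X j)) x y
  | IJump l' j => State (if 0 < X j then l' else l.+1) X x y
  | IRead i => State l.+1 (upd X i (head 0 x)) (behead x) y
  | IPrint i => State l.+1 X x (rcons y (X i))
  end.

Definition halted (P : program) (s : state) : bool := size P <= pc s.

Definition step (P : program) (s : state) : state :=
  if onth P (pc s) is Some c then exec c s else s.

Definition init (x : seq nat) : state := State 0 (fun=> 0) x [::].

Definition run (P : program) (x : seq nat) (t : nat) : state :=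
  iter t (step P) (init x).

Definition outputs (P : program) (x y : seq nat) : Prop :=
  exists t, halted P (run P x t) /\ output (run P x t) = y.

(* [P] runs in polynomial time on the inputs satisfying [I]. *)
Definition polynomial_time (P : program) (I : seq nat -> Prop) : Prop :=
  exists c k : nat, forall x, I x -> halted P (run P x (c * size x ^ k + c)).

(* The order of the graph, followed by its adjacency matrix, row by row. *)
Definition encode_graph n (G : sgraph 'I_n) : seq nat :=
  n :: [seq nat_of_bool (G u v) | u <- enum 'I_n, v <- enum 'I_n].

Definition encode_set n (D : {set 'I_n}) : seq nat :=
  [seq val v | v <- enum D].

Definition is_instance (x : seq nat) : Prop :=
  exists n (G : sgraph 'I_n), connected G /\ x = encode_graph G.

Definition approximation_algorithm (R : numDomainType) (alpha : nat)
    (r : nat -> R) (P : program) : Prop :=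
  forall n (G : sgraph 'I_n), connected G ->
  exists D : {set 'I_n},
    [/\ outputs P (encode_graph G) (encode_set D),
        feasible G alpha D &
        (#|D|%:R <= r n * (optimum G alpha)%:R)%R].

(* Main.v *)
Require Import Defs.
From mathcomp Require Import all_boot all_order all_algebra zify lra.
(* Let S be the greedy dominating set, so |S| <= H_n opt, and add to S, for every two
   of its vertices at distance at most 4, the inner vertices of a path of length at
   most 4 between them. If w is a common neighbour of u and v, and a, b in S dominate
   u and v, then a, u, w, v, b shows that a and b have been connected, so [u,v] is
   covered with at most 5 inner vertices. The result D has at most
   min(n, 4 |S|^2) <= 2 sqrt(n) |S| vertices.

   The machine model is handled by a small structured language, whose loops all
   run from 0 to n - 1, compiled to the random access machine; a Hoare triple bounds
   the running time by a cost that is polynomial in n for every program. *)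
Set Implicit Arguments.
Unset Strict Implicit.
Unset Printing Implicit Defensive.
Import Order.TTheory GRing.Theory Num.Theory.

(** * Distances and coverage *)

Section Distance.
Variables (T : finType) (G : sgraph T).
Implicit Types (u v w : T) (p : seq T).

(** [dist] searches only paths without repeated vertices, so the walk is shortened first; its
    distinct vertices then bound its length below [#|T|], within the range of the search. *)
Lemma dist_le u v p : path G u p -> last u p = v ->
  dist G u v < #|T| /\ dist G u v <= size p.
Proof.
move=> Gp; case: (shortenP Gp) => q Gq Uq sqp lq.
have lt_q : size q < #|T|.
  by rewrite -[(size q).+1]/(size (u :: q)) -(card_uniqP Uq) max_card.
have le_qp : size q <= size p.
  by apply: uniq_leq_size sqp; case/andP: Uq.
suff le_dq : dist G u v <= size q.
  by split; [apply: leq_ltn_trans lt_q | apply: leq_trans le_qp].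
rewrite leqNgt; apply/negP => lt_qd.
have := before_find 0 lt_qd; rewrite nth_iota // add0n => /negbT/negP[].
by apply/existsP; exists (in_tuple q); rewrite /is_path Gq lq eqxx.
Qed.

Lemma dist_path u v : dist G u v < #|T| ->
  exists p, [/\ size p = dist G u v, path G u p & last u p = v].
Proof.
rewrite /dist => lt_dT; have := lt_dT; rewrite -{2}(size_iota 0 #|T|) -has_find.
move/(nth_find 0); rewrite nth_iota // add0n => /existsP[p /and3P[Gp /eqP lp _]].
by exists p; rewrite size_tuple.
Qed.

Lemma target_couple_common u v : target_couple G u v -> exists w, G u w && G w v.
Proof.
rewrite /target_couple /internal; case: ifP => // lt_dT /eqP[d1].
have [p [szp Gp lp]] := dist_path lt_dT; case: (dist G u v) d1 szp => [|[|[]]] //= _.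
by case: p Gp lp => [|w [|v' []]] //= /andP[Guw /andP[Gwv _]] <-; exists w; apply/andP.
Qed.

(* Adjacency with loops, so that a walk may also stay where it is. *)
Definition cadj u v := (u == v) || G u v.

Lemma cadj_refl : reflexive cadj.
Proof. by move=> u; rewrite /cadj eqxx. Qed.

Lemma cadj_sym : symmetric cadj.
Proof. by move=> u v; rewrite /cadj eq_sym edge_sym. Qed.

Lemma cadj_path_proper u p : path cadj u p ->
  exists q, [/\ path G u q, last u q = last u p & size q <= size p].
Proof.
elim: p u => [|v p IHp] u /=; first by exists [::].
case/andP=> Auv /IHp[q [Gq lq szq]].
case/orP: Auv => [/eqP-> | Guv]; first by exists q; rewrite leqW.
by exists (v :: q); rewrite /= Guv.
Qed.

End Distance.

Section Coverage.
Variables (T : finType) (G : sgraph T) (alpha : nat).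
Implicit Types (u v w : T) (S D : {set T}).

(** The walk is lifted to the induced subgraph and its stationary steps are dropped. Allowing such
    steps spares a case analysis on coinciding vertices; [alpha.+1] edges mean [alpha] inner
    vertices. *)
Lemma covers_walk D u v p : path (cadj G) u p -> last u p = v ->
  {subset p <= D :|: [set u; v]} -> size p <= alpha.+1 -> covers G alpha D u v.
Proof.
move=> Ap lp sp szp; set S := D :|: [set u; v] in sp *.
pose H := induced G S; pose uS : {x | x \in S} := exist _ u (in_endl D u v).
pose vS : {x | x \in S} := exist _ v (in_endr D u v).
have [q [Aq lq szq]] : exists q, [/\ path (cadj H) uS q, last uS q = vS & size q = size p].
  have: val uS = u by [].
  elim: p (u) uS Ap lp sp {szp} => [|w p IHp] x xS /=.
    by move=> _ xv _ xSx; exists [::]; split=> //=; apply: val_inj; rewrite /= xSx.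
  case/andP=> Axw Ap lp sp xSx; have Sw : w \in S by rewrite sp ?mem_head.
  have [|q [Aq lq szq]] := IHp w (exist _ w Sw) Ap lp _ erefl.
    by move=> z pz; rewrite sp // inE pz orbT.
  exists (exist _ w Sw :: q); split=> //=; last by rewrite szq.
  by rewrite Aq andbT /cadj -val_eqE /= /induced_edge /= xSx.
have [q' [Hq' lq' szq']] := cadj_path_proper Aq.
have [lt_d le_d] := dist_le Hq' (etrans lq' lq).
have le_da : dist H uS vS <= alpha.+1.
  by rewrite (leq_trans le_d) // (leq_trans szq') // szq.
by rewrite /covers /internal_via /internal lt_d; case: (dist _ _ _) le_da.
Qed.

Lemma feasible_setT : 0 < alpha -> feasible G alpha [set: T].
Proof.
move=> alpha0; apply/andP; split; first by apply/forallP=> u; rewrite inE.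
apply/forallP=> u; apply/forallP=> v; apply/implyP=> /target_couple_common[w /andP[uw wv]].
apply: (@covers_walk _ _ _ [:: w; v]) => //=; first by rewrite /cadj uw wv !orbT.
by move=> x; rewrite !inE.
Qed.

(** The approximation ratio rests on domination alone. Feasibility of the full set makes the minimum
    in [optimum] meaningful. *)
Lemma optimum_dominating : 0 < alpha ->
  exists2 D, dominating G D & #|D| = optimum G alpha.
Proof.
move/feasible_setT=> fT; rewrite /optimum.
by case: arg_minnP => // D /andP[domD _] _; exists D.
Qed.

Lemma dominating_cadj D : dominating G D -> forall u, exists2 v, v \in D & cadj G v u.
Proof.
move=> /forallP domD u; have [Du | nDu] := boolP (u \in D).
  by exists u; rewrite ?cadj_refl.
have /existsP[v /andP[Dv Guv]] := implyP (domD u) nDu.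
by exists v; rewrite // cadj_sym /cadj Guv orbT.
Qed.

(* A target couple [u,v] with common neighbour w is covered through
   u - a - x - y - z - b - v, where a and b dominate u and v: the pair (a, b) is
   joined by the walk a, u, w, v, b, so some x, y, z exist. *)
Lemma feasible_joined S D : 5 <= alpha ->
  (forall u, exists2 a, a \in S & cadj G a u) -> S \subset D ->
  (forall a b, a \in S -> b \in S ->
    (exists p, path (cadj G) a (rcons p b) /\ size p = 3) ->
    exists p, [/\ path (cadj G) a (rcons p b), size p = 3 & {subset p <= D}]) ->
  feasible G alpha D.
Proof.
move=> alpha5 domS /subsetP sSD joined; apply/andP; split.
  apply/forallP=> u; apply/implyP=> nDu; have [a Sa] := domS u.
  case/orP=> [/eqP au | Gau]; first by rewrite -au sSD in nDu.
  by apply/existsP; exists a; rewrite sSD // edge_sym.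
apply/forallP=> u; apply/forallP=> v; apply/implyP=> /target_couple_common[w /andP[uw wv]].
have [a Sa au] := domS u; have [b Sb bv] := domS v.
have [|p [Ap szp sp]] := joined a b Sa Sb.
  by exists [:: u; w; v]; split=> //=; rewrite au (cadj_sym G v) bv /cadj uw wv !orbT.
apply: (@covers_walk _ _ _ (a :: rcons (rcons p b) v)); last by rewrite /= !size_rcons szp.
- by rewrite /= cadj_sym au rcons_path Ap last_rcons.
- by rewrite /= last_rcons.
move=> x; rewrite !inE !mem_rcons !inE mem_rcons inE.
by case/or4P=> [/eqP->|/eqP->|/eqP->|/sp->]; rewrite ?eqxx ?orbT // sSD.
Qed.

End Coverage.

(** * Greedy dominating set *)

Lemma foldl_stable (A B : Type) (P : A -> Prop) (f : A -> B -> A) s t :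
  (forall t c, P t -> P (f t c)) -> P t -> P (foldl f t s).
Proof. by move=> fP; elim: s t => //= c s IHs t Pt; apply/IHs/fP. Qed.

Lemma foldl_reach (A : Type) (B : eqType) (P : A -> Prop) (f : A -> B -> A) s t b :
  b \in s -> (forall t, P (f t b)) -> (forall t c, P t -> P (f t c)) -> P (foldl f t s).
Proof.
move=> sb fb fP; elim: s t sb => //= c s IHs t; rewrite inE => /predU1P[<- | /IHs//].
exact: foldl_stable.
Qed.

Lemma foldl_enum_ord_ind n (A : Type) (I : nat -> A -> Prop) (f : A -> 'I_n -> A) x :
  I 0 x -> (forall (k : 'I_n) y, I k y -> I k.+1 (f y k)) -> I n (foldl f x (enum 'I_n)).
Proof.
move=> I0 If; rewrite -{1}[n]add0n -{1}(size_enum_ord n).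
(* The induction runs over suffixes of the enumeration, whose values start at an arbitrary [m]. *)
have: map val (enum 'I_n) = iota 0 (size (enum 'I_n)) by rewrite val_enum_ord size_enum_ord.
elim: (enum _) 0 x I0 => [|k s IHs] m x Im /=; first by rewrite addn0.
by case=> km es; rewrite -addSnnS; apply: IHs => //; rewrite -km; apply: If; rewrite km.
Qed.

Section Greedy.
Variables (n : nat) (G : sgraph 'I_n).
Implicit Types (u v a b : 'I_n) (S D : {set 'I_n}).

Definition dominated S u := [exists a in S, cadj G a u].

Definition gain S v := #|[set u | cadj G v u & ~~ dominated S u]|.

Definition greedy_step (k : nat) S v := if n <= gain S v + k then v |: S else S.

(* Pass k accepts the vertices whose gain is at least n - k. At the start of that
   pass every gain is at most n - k, so this is the usual greedy rule without
   an explicit maximisation. *)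
Definition greedy : {set 'I_n} :=
  foldl (fun S (k : 'I_n) => foldl (greedy_step k) S (enum 'I_n)) set0 (enum 'I_n).

Lemma dominatedU1 v S u : dominated (v |: S) u = cadj G v u || dominated S u.
Proof.
apply/existsP/idP => [[a /andP[/setU1P[->|Sa] Gau]] | /orP[Gvu | /existsP[a /andP[Sa Gau]]]].
- by rewrite Gau.
- by apply/orP; right; apply/existsP; exists a; rewrite Sa.
- by exists v; rewrite setU11.
- by exists a; rewrite setU1r.
Qed.

Lemma gainU1 v S a : gain (v |: S) a <= gain S a.
Proof.
apply/subset_leq_card/subsetP=> u; rewrite !inE dominatedU1 negb_or.
by case/and3P=> -> _ ->.
Qed.

Lemma gainU1_id v S : gain (v |: S) v = 0.
Proof.
by apply/eqP; rewrite cards_eq0 -subset0; apply/subsetP=> u; rewrite !inE dominatedU1; case: cadj.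
Qed.

Lemma gain_greedy_step k S v a : gain (greedy_step k S v) a <= gain S a.
Proof. by rewrite /greedy_step; case: ifP => // _; apply: gainU1. Qed.

(** When visited, [a] is either accepted, and its gain drops to 0, or rejected because its gain is
    below [n - k]. Later steps never raise a gain. *)
Lemma greedy_pass_gain k S (s : seq 'I_n) a : k < n -> a \in s ->
  gain (foldl (greedy_step k) S s) a + k < n.
Proof.
move=> lt_kn.
have gain_foldl s' S' : gain (foldl (greedy_step k) S' s') a <= gain S' a.
  by elim: s' S' => //= v s' IHs S'; apply: leq_trans (IHs _) (gain_greedy_step _ _ _ _).
elim: s S => //= v s IHs S; rewrite inE => /predU1P[<- | /IHs//].
apply: leq_ltn_trans (_ : gain (greedy_step k S a) a + k < n); first by rewrite leq_add2r.
by rewrite /greedy_step; case: ifP => [_|/negbT]; rewrite ?gainU1_id // -ltnNge.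
Qed.


Lemma greedy_gain v : gain greedy v = 0.
Proof.
suff: forall a, gain greedy a + n <= n by move/(_ v); rewrite -{2}[n]add0n leq_add2r leqn0 => /eqP.
rewrite /greedy; apply: (foldl_enum_ord_ind (I := fun k S => forall a, gain S a + k <= n)).
  by move=> a; rewrite addn0 -[X in _ <= X]card_ord max_card.
by move=> k S _ a; rewrite addnS greedy_pass_gain ?mem_enum.
Qed.

Lemma greedy_dominating u : exists2 a, a \in greedy & cadj G a u.
Proof.
suff /existsP[a /andP[]]: dominated greedy u by exists a.
apply: contraT => ndu; move/eqP: (greedy_gain u); rewrite cards_eq0 => /eqP/setP/(_ u).
by rewrite !inE cadj_refl ndu.
Qed.

Definition undominated S := [set u | ~~ dominated S u].

Lemma undominatedU1 v S : #|undominated (v |: S)| + gain S v = #|undominated S|.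
Proof.
rewrite -(cardsID [set u | cadj G v u] (undominated S)) addnC; congr (_ + _).
  by apply: eq_card => u; rewrite !inE andbC.
by apply: eq_card => u; rewrite !inE dominatedU1 negb_or.
Qed.

(** Every undominated vertex is counted in the gain of a vertex of [D] that dominates it. *)
Lemma undominated_le_gain D S k : dominating G D ->
  (forall v, gain S v <= k) -> #|undominated S| <= #|D| * k.
Proof.
move=> domD le_k; rewrite -sum_nat_const.
apply: leq_trans (_ : \sum_(v in D) gain S v <= _); last by apply: leq_sum.
have sub : undominated S \subset \bigcup_(v in D) [set u | cadj G v u & ~~ dominated S u].
  apply/subsetP=> u; rewrite inE => ndu; have [v Dv Gvu] := dominating_cadj domD u.
  by apply/bigcupP; exists v => //; rewrite inE Gvu.
apply: leq_trans (subset_leq_card sub) _.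
elim/big_ind2: _ => [|A a B b le_a le_b|//]; first by rewrite cards0.
by apply: leq_trans (leq_card_setU _ _) _; apply: leq_add.
Qed.

(** * Size of the greedy set, by a potential argument *)

Section Potential.
Variable R : realFieldType.
Local Open Scope ring_scope.

Definition harmonic_sum m : R := \sum_(i < m) i.+1%:R^-1.

(** Each of the [k] additional terms is at least [1 / (m + k)]. *)
Lemma harmonic_sumD m k : (0 < k)%N -> k%:R / (m + k)%:R <= harmonic_sum (m + k) - harmonic_sum m.
Proof.
move=> k_gt0; rewrite /harmonic_sum big_split_ord /= addrAC subrr add0r.
rewrite mulr_natl -[X in _ *+ X]card_ord -sumr_const; apply: ler_sum => i _.
by rewrite lef_pV2 ?posrE ?ltr0n ?addn_gt0 ?k_gt0 ?orbT // ler_nat ltn_add2l.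
Qed.

Variable D : {set 'I_n}.
Hypothesis domD : dominating G D.

Definition potential S : R := #|S|%:R + #|D|%:R * harmonic_sum #|undominated S|.

(* With every gain at most g = gain S v, at most |D| g vertices are still undominated,
   so covering g of them lowers the harmonic sum by at least 1 / |D|. *)
Lemma potential_greedy_step (k : 'I_n) S v :
  (forall a, gain S a + k <= n)%N -> potential (greedy_step k S v) <= potential S.
Proof.
move=> le_n; rewrite /greedy_step; case: ifP => // le_nk.
have lt_kn := ltn_ord k.
have g_gt0 : (0 < gain S v)%N by rewrite -(ltn_add2r k) (leq_trans lt_kn).
(* Acceptance means [n - k <= gain S v], while [le_n] bounds every gain by [n - k], so [v] has
   maximal gain. *)
have le_g a : (gain S a <= gain S v)%N by rewrite -(leq_add2r k) (leq_trans (le_n a)).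
have le_U := undominated_le_gain domD le_g.
have := harmonic_sumD #|undominated (v |: S)| g_gt0; rewrite undominatedU1 => dH.
have U_gt0 : (0 < #|undominated S|)%N by rewrite -(undominatedU1 v) addn_gt0 g_gt0 orbT.
have : 1 <= #|D|%:R * (harmonic_sum #|undominated S| - harmonic_sum #|undominated (v |: S)|).
  apply: le_trans (ler_wpM2l (ler0n _ _) dH).
  by rewrite mulrA ler_pdivlMr ?ltr0n // mul1r -natrM ler_nat.
rewrite mulrBr lerBrDr => dP; rewrite /potential.
have cU : (#|v |: S|%:R : R) <= #|S|%:R + 1 by rewrite natr1 ler_nat cardsU1; case: (_ \notin _).
by rewrite (le_trans (lerD cU (lexx _))) // -addrA lerD2l.
Qed.

(** The potential starts at [#|D| * harmonic_sum n], never increases and bounds the number of chosen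
    vertices. The invariant also carries the bound on gains that [potential_greedy_step]
    requires. *)
Lemma card_greedy : #|greedy|%:R <= #|D|%:R * harmonic_sum n.
Proof.
suff [le_pot _] : potential greedy <= #|D|%:R * harmonic_sum n /\ forall a, (gain greedy a + n <= n)%N.
  apply: le_trans le_pot; rewrite lerDl mulr_ge0 ?ler0n // sumr_ge0 // => i _.
  by rewrite invr_ge0 ler0n.
rewrite {1 2}/greedy.
apply: (foldl_enum_ord_ind
  (I := fun k S => potential S <= #|D|%:R * harmonic_sum n /\ forall a, (gain S a + k <= n)%N)).
  split=> [|a]; last by rewrite addn0 -[X in (_ <= X)%N]card_ord max_card.
  rewrite /potential cards0 add0r (_ : undominated set0 = setT) ?cardsT ?card_ord //.
  by apply/setP=> u; rewrite !inE; apply/existsP=> -[a]; rewrite inE.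
move=> k S [pS gS]; split=> [|a]; last by rewrite addnS greedy_pass_gain ?mem_enum.
elim: (enum _) S pS gS => //= v s IHs S pS gS; apply: IHs.
  by apply: le_trans pS; apply: potential_greedy_step.
by move=> a; apply: leq_trans (gS a); rewrite leq_add2r gain_greedy_step.
Qed.

End Potential.
End Greedy.

(** * Joining the chosen vertices *)

Section Joining.
Variables (n : nat) (G : sgraph 'I_n).
Implicit Types (u v a b x y z : 'I_n) (S D : {set 'I_n}) (t : 'I_n * 'I_n * 'I_n).

Definition joins a b t := path (cadj G) a [:: t.1.1; t.1.2; t.2; b].

(** Exhaustive search keeping the last triple found. The default [(a, a, a)] is harmless: for a pair
    that cannot be joined, it contributes no vertex other than [a]. *)
Definition joiner a b : 'I_n * 'I_n * 'I_n :=
  foldl (fun t x => foldl (fun t y => foldl (fun t z =>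
    if joins a b (x, y, z) then (x, y, z) else t)
    t (enum 'I_n)) t (enum 'I_n)) (a, a, a) (enum 'I_n).

Definition add_joiner a D b : {set 'I_n} :=
  let: (x, y, z) := joiner a b in z |: (y |: (x |: (a |: D))).

(** Starting from [set0] suffices, since each [a] in [S] is inserted when the pair [(a, a)] is
    treated. *)
Definition join_all S : {set 'I_n} :=
  foldl (fun D a => if a \in S then
    foldl (fun D b => if b \in S then add_joiner a D b else D) D (enum 'I_n) else D)
  set0 (enum 'I_n).

(** A joining triple is only ever replaced by another one, so it is enough that the three loops
    reach [t]. *)
Lemma joiner_joins a b t : joins a b t -> joins a b (joiner a b).
Proof.
case: t => [[x y] z] abt; pose P t := is_true (joins a b t).
have Pz t' x' y' z' : P t' -> P (if joins a b (x', y', z') then (x', y', z') else t').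
  by case: ifP.
apply: (@foldl_reach _ _ P _ _ _ x); [by rewrite mem_enum| move=> t1| move=> t1 x1 P1].
  apply: (@foldl_reach _ _ P _ _ _ y); [by rewrite mem_enum| move=> t2| move=> t2 y2 P2].
    apply: (@foldl_reach _ _ P _ _ _ z); [by rewrite mem_enum| move=> t3| move=> t3 z3 P3].
      by rewrite abt.
    exact: Pz.
  by apply: foldl_stable P2 => *; apply: Pz.
by apply: foldl_stable P1 => *; apply: foldl_stable => // *; apply: Pz.
Qed.

Lemma add_joinerP a D b : [/\ D \subset add_joiner a D b, a \in add_joiner a D b,
  {subset [:: (joiner a b).1.1; (joiner a b).1.2; (joiner a b).2] <= add_joiner a D b} &
  #|add_joiner a D b| <= #|D| + 4].
Proof.
rewrite /add_joiner; case: (joiner a b) => [[x y] z] /=; split.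
- by apply/subsetP=> w Dw; rewrite !inE Dw !orbT.
- by rewrite !inE eqxx !orbT.
- by move=> w; rewrite !inE => /or3P[] ->; rewrite ?orbT.
rewrite !cardsU1; move: (z \notin _) (y \notin _) (x \notin _) (a \notin _).
by do 4 case=> //=; lia.
Qed.

Lemma card_foldl_if (f : {set 'I_n} -> 'I_n -> {set 'I_n}) S D c s :
  (forall D a, a \in S -> #|f D a| <= #|D| + c) ->
  #|foldl (fun D a => if a \in S then f D a else D) D s| <= #|D| + c * count (mem S) s.
Proof.
move=> le_f; elim: s D => [|a s IHs] D /=; first by rewrite muln0 addn0.
apply: leq_trans (IHs _) _; rewrite mulnDr addnA leq_add2r.
by case: ifP => [/le_f|_]; rewrite ?muln1 ?muln0 ?addn0.
Qed.

Lemma count_enum_mem S : count (mem S) (enum 'I_n) = #|S|.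
Proof. by rewrite cardE -size_filter enumT. Qed.

Lemma card_join_all S : #|join_all S| <= 4 * #|S| ^ 2.
Proof.
(* The bound takes the shape required by [card_foldl_if]: 4 vertices for each [b], hence [4 * #|S|]
   for each [a], starting from an empty set. *)
rewrite expnS mulnA -[X in _ <= X]add0n -[X in X + _](cards0 'I_n) expn1 -[X in _ * X]count_enum_mem.
apply: card_foldl_if => D a Sa; rewrite -(count_enum_mem S).
by apply: card_foldl_if => {}D b Sb; have [] := add_joinerP a D b.
Qed.

Lemma join_all_joined S a b : a \in S -> b \in S ->
  {subset [:: a; (joiner a b).1.1; (joiner a b).1.2; (joiner a b).2] <= join_all S}.
Proof.
move=> Sa Sb w abw.
have grow D a' b' : w \in D -> w \in (if b' \in S then add_joiner a' D b' else D).
  by case: ifP => // _; have [/subsetP sD _ _ _] := add_joinerP a' D b'; apply: sD.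
apply: (@foldl_reach _ _ (fun D => w \in D) _ _ _ a); [by rewrite mem_enum| move=> D| move=> D c Dw].
  rewrite Sa; apply: (@foldl_reach _ _ (fun D => w \in D) _ _ _ b); [by rewrite mem_enum| |].
    move=> {}D; rewrite Sb; have [_ Da Dj _] := add_joinerP a D b.
    by move: abw; rewrite inE => /predU1P[-> // | /Dj].
  by move=> {}D c; apply: grow.
by case: ifP => // _; apply: (foldl_stable (P := fun D => w \in D)) Dw => *; apply: grow.
Qed.

Definition approx_solution : {set 'I_n} := join_all (greedy G).

Lemma feasible_approx alpha : 5 <= alpha -> feasible G alpha approx_solution.
Proof.
move=> alpha5; apply: (feasible_joined (S := greedy G) alpha5).
- exact: greedy_dominating.
- by apply/subsetP=> a Sa; apply: (join_all_joined Sa Sa); rewrite ?mem_head.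
move=> a b Sa Sb [[|x [|y [|z [|? ?]]]] [Ap szp]] //.
exists [:: (joiner a b).1.1; (joiner a b).1.2; (joiner a b).2]; split=> //.
  exact: (@joiner_joins _ _ (x, y, z)).
by move=> w abw; apply: (join_all_joined Sa Sb); rewrite in_cons abw orbT.
Qed.

End Joining.

(** * A structured language on the random access machine *)

(* Structured programs. Memory is a family of arrays, interleaved in the registers:
   cell [j] of array [a] is register [8 * j + a]. Array 0 holds the variables,
   variable 0 being the bound of all loops, and array 1 is scratch space. *)
Inductive op :=
| OConst of nat & nat
| OMov of nat & nat
| OAdd of nat & nat & nat
| OSub of nat & nat & nat
| OGet of nat & nat & nat
| OPut of nat & nat & nat
| ORead of nat
| OPrint of nat.

Inductive cmd :=
| Do of seq op
| Seq of cmd & cmd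
| Unless of nat & cmd
| For of nat & cmd.

Record astate := AState { cells : nat -> nat -> nat; inp : seq nat; out : seq nat }.

Definition set_cell (m : nat -> nat -> nat) (a j v : nat) : nat -> nat -> nat :=
  fun a' j' => if (a' == a) && (j' == j) then v else m a' j'.

Definition set_var i v s := AState (set_cell (cells s) 0 i v) (inp s) (out s).

Definition op_sem (s : astate) (o : op) : astate :=
  let: AState m x y := s in
  match o with
  | OConst i c => AState (set_cell m 0 i c) x y
  | OMov i j => AState (set_cell m 0 i (m 0 j)) x y
  | OAdd i j k => AState (set_cell m 0 i (m 0 j + m 0 k)) x y
  | OSub i j k => AState (set_cell m 0 i (m 0 j - m 0 k)) x y
  | OGet i a j => AState (set_cell m 0 i (m a (m 0 j))) x y
  | OPut a j i => AState (set_cell m a (m 0 j) (m 0 i)) x y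
  | ORead i => AState (set_cell m 0 i (head 0 x)) (behead x) y
  | OPrint i => AState m x (rcons y (m 0 i))
  end.

Definition op_wf (o : op) : bool :=
  match o with OGet _ a _ | OPut a _ _ => 1 < a < 8 | _ => true end.

Definition var i := 8 * i.

(** Registers 1 and 9 are cells 0 and 1 of the scratch array. Three doublings give the factor 8. *)
Definition compute_address a j : seq instr :=
  [:: IAdd 1 (var j) (var j); IAdd 1 1 1; IAdd 1 1 1; IConst 9 a; IAdd 1 1 9].

Definition compile_op (o : op) : seq instr :=
  match o with
  | OConst i c => [:: IConst (var i) c]
  | OMov i j => [:: IConst 1 0; IAdd (var i) (var j) 1]
  | OAdd i j k => [:: IAdd (var i) (var j) (var k)]
  | OSub i j k => [:: ISub (var i) (var j) (var k)]
  | OGet i a j => rcons (compute_address a j) (ILoad (var i) 1)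
  | OPut a j i => rcons (compute_address a j) (IStore 1 (var i))
  | ORead i => [:: IRead (var i)]
  | OPrint i => [:: IPrint (var i)]
  end.

Fixpoint code_size (c : cmd) : nat :=
  match c with
  | Do os => size (flatten (map compile_op os))
  | Seq c1 c2 => code_size c1 + code_size c2
  | Unless _ c => (code_size c).+1
  | For _ c => (code_size c + 4).+1
  end.

(* [compile l c] is the code of [c] when placed at line [l]. The body of a [For]
   is executed before the first test, so the bound must be positive. *)
Fixpoint compile (l : nat) (c : cmd) : seq instr :=
  match c with
  | Do os => flatten (map compile_op os)
  | Seq c1 c2 => compile l c1 ++ compile (l + code_size c1) c2
  | Unless j c => IJump (l.+1 + code_size c) (var j) :: compile l.+1 c
  | For i c => IConst (var i) 0 :: compile l.+1 c ++
      [:: IConst 1 1; IAdd (var i) (var i) 1; ISub 1 (var 0) (var i); IJump l.+1 1]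
  end.

Fixpoint cost (n : nat) (c : cmd) : nat :=
  match c with
  | Do os => size (flatten (map compile_op os))
  | Seq c1 c2 => cost n c1 + cost n c2
  | Unless _ c => (cost n c).+1
  | For _ c => (n * (cost n c + 4)).+1
  end.

Lemma size_compile l c : size (compile l c) = code_size c.
Proof.
elim: c l => //= [c1 IH1 c2 IH2 | j c IH | i c IH] l; rewrite ?size_cat ?IH ?IH1 ?IH2 //.
Qed.

Lemma cost_polynomial c : exists C d, forall n, cost n c <= C * n.+1 ^ d.
Proof.
elim: c => [os | c1 [C1 [d1 IH1]] c2 [C2 [d2 IH2]] | j c [C [d IH]] | i c [C [d IH]]] /=.
- by exists (size (flatten (map compile_op os))), 0 => n; rewrite expn0 muln1.
- exists (C1 + C2), (d1 + d2) => n; rewrite mulnDl.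
  apply: leq_add; [apply: leq_trans (IH1 n) _ | apply: leq_trans (IH2 n) _].
    by rewrite leq_mul2l leq_pexp2l ?orbT ?leq_addr.
  by rewrite leq_mul2l leq_pexp2l ?orbT ?leq_addl.
- exists C.+1, d => n; rewrite mulSn -add1n leq_add ?expn_gt0 //.
(* In the constant, 4 pays for the loop control of each iteration and 1 for setting the counter to
   zero. *)
exists (C + 5), d.+1 => n; have := IH n.
have: 0 < n.+1 ^ d by rewrite expn_gt0.
by rewrite expnS; move: (n.+1 ^ d) (cost n c) => p q; nia.
Qed.

(** * Execution of compiled code *)

Section Logic.
Variable P : program.

Definition code_at l (cs : seq instr) := exists P1 P2, P = P1 ++ cs ++ P2 /\ size P1 = l.

Lemma code_at_cat l c1 c2 : code_at l (c1 ++ c2) -> code_at l c1 /\ code_at (l + size c1) c2.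
Proof.
case=> P1 [P2 [eP <-]]; split; first by exists P1, (c2 ++ P2); rewrite eP !catA.
by exists (P1 ++ c1), P2; rewrite eP size_cat !catA.
Qed.

Lemma step_code_at l c cs s : code_at l (c :: cs) -> pc s = l -> step P s = exec c s.
Proof.
case=> P1 [P2 [eP <-]] pcs; rewrite /step pcs eP.
by rewrite onthE map_cat nth_cat size_map ltnn subnn.
Qed.

Definition straight (c : instr) := if c is IJump _ _ then false else true.

Lemma pc_exec_straight c s : straight c -> pc (exec c s) = (pc s).+1.
Proof. by case: s; case: c. Qed.

Lemma run_straight l cs s : code_at l cs -> pc s = l -> all straight cs ->
  iter (size cs) (step P) s = foldl (fun s c => exec c s) s cs.
Proof.
elim: cs l s => //= c cs IH l s Pcs pcs /andP[sc scs].
rewrite -iterS iterSr (step_code_at Pcs pcs) (IH l.+1) //; last by rewrite pc_exec_straight // pcs.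
by have [_] := @code_at_cat l [:: c] cs Pcs; rewrite addn1.
Qed.

(** Array 1 is exempt, so compiled code may overwrite scratch registers without changing the
    abstract memory. *)
Definition represents (X : nat -> nat) (m : nat -> nat -> nat) :=
  forall a j, a < 8 -> a != 1 -> X (8 * j + a) = m a j.

Lemma represents_var X m i : represents X m -> X (var i) = m 0 i.
Proof. by move/(_ 0 i)=> <- //; rewrite addn0. Qed.

Lemma represents_upd X m a j v : a < 8 -> a != 1 -> represents X m ->
  represents (upd X (8 * j + a) v) (set_cell m a j v).
Proof.
move=> lt_a ne_a Xm a' j' lt_a' ne_a'; rewrite /upd /set_cell Xm //.
have -> // : (8 * j' + a' == 8 * j + a) = (a' == a) && (j' == j).
apply/eqP/andP => [e | [/eqP-> /eqP->]] //.
by split; apply/eqP; lia.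
Qed.

Lemma represents_upd_var X m i v : represents X m ->
  represents (upd X (var i) v) (set_cell m 0 i v).
Proof. by move=> Xm; rewrite -[var i]addn0; apply: represents_upd. Qed.

Lemma represents_scratch X m j v : represents X m -> represents (upd X (8 * j + 1) v) m.
Proof.
move=> Xm a' j' lt_a' ne_a'; rewrite /upd; case: eqP => [e|_]; last exact: Xm.
by case/eqP: ne_a'; lia.
Qed.

Lemma upd1_var X v i : upd X 1 v (var i) = X (var i).
Proof. by rewrite /upd; case: eqP => //; rewrite /var; lia. Qed.

Lemma straight_compile_op o : all straight (compile_op o).
Proof. by case: o. Qed.

Lemma exec_compute_address l X x y a j :
  exists2 X', foldl (fun s c => exec c s) (State l X x y) (compute_address a j) = State (l + 5) X' x y
  & X' 1 = 8 * X (var j) + a /\ forall m, represents X m -> represents X' m.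
Proof.
rewrite /= !addnS addn0; eexists; first reflexivity.
split; first by rewrite /upd /=; lia.
by move=> m Xm; do ! [apply: (@represents_scratch _ _ 0) | apply: (@represents_scratch _ _ 1)].
Qed.

Lemma exec_compile_op l X m x y o : op_wf o -> represents X m ->
  exists2 X', let s := op_sem (AState m x y) o in
    foldl (fun s c => exec c s) (State l X x y) (compile_op o) =
      State (l + size (compile_op o)) X' (inp s) (out s)
  & represents X' (cells (op_sem (AState m x y) o)).
Proof.
case: o => [i c|i j|i j k|i j k|i a j|a j i|i|i] wf_o Xm; last first.
- by rewrite /= addn1 (represents_var _ Xm); exists X.
- by rewrite /= addn1; eexists; [reflexivity | apply: represents_upd_var].
- have [X' eX' [X1 /(_ _ Xm) X'm]] := exec_compute_address l X x y a j.
  rewrite foldl_rcons eX' /= X1 (represents_var _ Xm) (represents_var _ X'm) -addnS.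
  have [a_gt1 a_lt8] := andP wf_o.
  by eexists; [reflexivity | apply: represents_upd; rewrite ?gtn_eqF].
- have [X' eX' [X1 /(_ _ Xm) X'm]] := exec_compute_address l X x y a j.
  have [a_gt1 a_lt8] := andP wf_o; rewrite foldl_rcons eX' /= X1 (represents_var _ Xm) X'm //.
    by rewrite -addnS; eexists; [reflexivity | apply: represents_upd_var].
  by rewrite gtn_eqF.
- by rewrite /= addn1 !(represents_var _ Xm); eexists; [reflexivity | apply: represents_upd_var].
- by rewrite /= addn1 !(represents_var _ Xm); eexists; [reflexivity | apply: represents_upd_var].
- rewrite /= addn2 upd1_var (represents_var _ Xm) [upd X 1 0 1]/upd eqxx addn0.
  by eexists; [reflexivity | apply/represents_upd_var/(@represents_scratch _ _ 0)].
- by rewrite /= addn1; eexists; [reflexivity | apply: represents_upd_var].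
Qed.

End Logic.

(** * Hoare triples with running time *)

Section Hoare.
Variable n : nat.
Hypothesis n_gt0 : 0 < n.
Implicit Types (A B C : astate -> Prop) (I : nat -> astate -> Prop) (s : astate) (c : cmd).

(** Total correctness within [cost n c] steps, for code placed anywhere in any program; control
    leaves at the line just after that code. *)
Definition hoare A c B := forall P l s X,
  code_at P l (compile l c) -> represents X (cells s) -> A s ->
  exists t X' s', [/\ t <= cost n c,
    iter t (step P) (State l X (inp s) (out s)) =
      State (l + code_size c) X' (inp s') (out s'),
    represents X' (cells s') & B s'].

Lemma hoare_weaken A' B' A B c : (forall s, A s -> A' s) -> (forall s, B' s -> B s) ->
  hoare A' c B' -> hoare A c B.
Proof.
move=> AA' BB' h P l s X Pc Xs As; have [t [X' [s' [le_t e X's' Bs']]]] := h P l s X Pc Xs (AA' _ As).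
by exists t, X', s'; split=> //; apply: BB'.
Qed.

Lemma hoare_do A os B : all op_wf os -> (forall s, A s -> B (foldl op_sem s os)) ->
  hoare A (Do os) B.
Proof.
move=> wf_os AB P l s X Pc Xs /AB Bs.
suff [X' e X's']: exists2 X', foldl (fun st i => exec i st) (State l X (inp s) (out s)) (compile l (Do os))
    = State (l + code_size (Do os)) X' (inp (foldl op_sem s os)) (out (foldl op_sem s os))
    & represents X' (cells (foldl op_sem s os)).
  exists (size (compile l (Do os))), X', (foldl op_sem s os); split=> //.
  rewrite (run_straight Pc) //=.
  by elim: (os) => //= o os' IH; rewrite all_cat straight_compile_op.
elim: os l s X wf_os {AB Bs Pc} Xs => [|o os IH] l s X /=; first by exists X; rewrite ?addn0.
case/andP=> wf_o wf_os Xs; rewrite foldl_cat size_cat addnA; case: s Xs => m x y Xm.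
have [X1 e1 Xm1] := exec_compile_op l x y wf_o Xm.
by rewrite e1; apply: IH.
Qed.

Lemma hoare_seq B A C c1 c2 : hoare A c1 B -> hoare B c2 C -> hoare A (Seq c1 c2) C.
Proof.
move=> h1 h2 P l s X /= /code_at_cat[P1]; rewrite size_compile => P2 Xs As.
have [t1 [X1 [s1 [le1 e1 Xs1 Bs1]]]] := h1 _ _ _ _ P1 Xs As.
have [t2 [X2 [s2 [le2 e2 Xs2 Cs2]]]] := h2 _ _ _ _ P2 Xs1 Bs1.
exists (t2 + t1), X2, s2; split=> //; first by rewrite addnC leq_add.
by rewrite iterD e1 e2 addnA.
Qed.

Lemma hoare_unless A j c B : (forall s, A s -> 0 < cells s 0 j -> B s) ->
  hoare (fun s => A s /\ cells s 0 j = 0) c B -> hoare A (Unless j c) B.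
Proof.
move=> AB h P l s X /= Pc Xs As; have Xj := represents_var j Xs.
have step1 := step_code_at Pc (erefl (pc (State l X (inp s) (out s)))).
have [j0 | j_gt0] := posnP (cells s 0 j).
  have [_ P2] := @code_at_cat _ _ [:: _] _ Pc; rewrite addn1 in P2.
  have [t [X' [s' [le_t e X's' Bs']]]] := h _ _ _ _ P2 Xs (conj As j0).
  by exists t.+1, X', s'; split=> //; rewrite iterSr step1 /= Xj j0 /= e addSnnS.
by exists 1, X, s; split=> //=; [rewrite step1 /= Xj j_gt0 addSnnS | apply: AB].
Qed.

(** The compiled loop increments the counter itself and then compares it with variable 0. Hence the
    body must end with both values intact, and with the next invariant true once the counter is
    advanced. *)
Lemma hoare_for I A i c : (forall s, A s -> I 0 (set_var i 0 s)) ->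
  (forall k, k < n -> hoare (fun s => I k s /\ cells s 0 i = k) c
     (fun s => [/\ cells s 0 i = k, cells s 0 0 = n & I k.+1 (set_var i k.+1 s)])) ->
  hoare A (For i c) (I n).
Proof.
move=> AI h P l s X /= Pc Xs As.
have step1 := step_code_at Pc (erefl (pc (State l X (inp s) (out s)))).
have [_ ] := @code_at_cat _ _ [:: _] _ Pc; rewrite addn1 => /code_at_cat[P2]; rewrite size_compile => P3.
(* Induction on the number [d] of iterations left, the current one included; line [l.+1] is the
   start of the body. *)
suff loop d k s1 X1 : d + k = n -> 0 < d -> represents X1 (cells s1) -> I k s1 -> cells s1 0 i = k ->
    exists t X' s', [/\ t <= d * (cost n c + 4),
      iter t (step P) (State l.+1 X1 (inp s1) (out s1)) =
        State (l + (code_size c + 4).+1) X' (inp s') (out s'),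
      represents X' (cells s') & I n s'].
  have Xs1 : represents (upd X (var i) 0) (cells (set_var i 0 s)) by apply: represents_upd_var.
  have [|t [X' [s' [le_t e X's' Is']]]] := loop n 0 _ _ (addn0 n) n_gt0 Xs1 (AI _ As).
    by rewrite /= /set_cell !eqxx.
  by exists t.+1, X', s'; split=> //; rewrite iterSr step1 /= e.
elim: d k s1 X1 => // d IHd k s1 X1 dk _ Xs1 Ik ik.
have lt_kn : k < n by lia.
have [t [X2 [s2 [le_t e Xs2 [i2 n2 Ik2]]]]] := h k lt_kn _ _ _ _ P2 Xs1 (conj Ik ik).
have [P4 P5] := @code_at_cat _ _ [:: _; _; _] [:: _] P3.
have := run_straight (s := State (l.+1 + code_size c) X2 (inp s2) (out s2)) P4 erefl isT.
rewrite /=; set X3 := upd (upd X2 1 1) (var i) _.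
have Xs3 : represents X3 (cells (set_var i k.+1 s2)).
  rewrite /X3 upd1_var (represents_var _ Xs2) i2 [upd X2 1 1 1]/upd eqxx addn1.
  by apply/represents_upd_var/(@represents_scratch _ _ 0).
rewrite (represents_var 0 Xs3) (represents_var i Xs3) /= /set_cell !eqxx /=.
(* The counter is not variable 0, since the two hold [k < n] and [n] after the body. *)
have -> : (0 == i) = false by apply/negP => /eqP i0; rewrite -i0 n2 in i2; lia.
(* Register 1 receives the number of iterations still to come, so the jump back is taken exactly
   when [d] is positive. *)
rewrite n2 (_ : n - k.+1 = d); last by lia.
set X4 := upd X3 1 d => e3.
have Xs4 : represents X4 (cells (set_var i k.+1 s2)) by apply: (@represents_scratch _ _ 0).
have e4 : iter (t + 4) (step P) (State l.+1 X1 (inp s1) (out s1)) =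
    State (if 0 < d then l.+1 else (l.+1 + code_size c + 3).+1) X4 (inp s2) (out s2).
  rewrite addnC -[4]/(1 + 3) -addnA iterD iterD e [iter 3 _ _]e3.
  by rewrite /= (step_code_at P5) /= ?addnS ?addn0 // {2}/X4 /upd eqxx.
have [d0 | d_gt0] := posnP d; last first.
  have [||t' [X' [s' [le_t' e' X's' Is']]]] := IHd k.+1 _ _ _ d_gt0 Xs4 Ik2.
  - by rewrite addnS.
  - by rewrite /= /set_cell !eqxx.
  exists (t' + (t + 4)), X', s'; split=> //; first by rewrite mulSn; lia.
  by rewrite iterD e4 d_gt0 e'.
exists (t + 4), X4, (set_var i k.+1 s2); split=> //; first by rewrite mulSn; lia.
  by rewrite e4 d0; congr State; lia.
by have <- : k.+1 = n by lia.
Qed.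

(** This ties loops to the folds over [enum 'I_n] that define the mathematical algorithm: after [k]
    iterations the state represents the fold over the first [k] elements. *)
Lemma hoare_for_foldl (A : Type) (R : A -> astate -> Prop) (f : A -> 'I_n -> A) x i c :
  (forall x v s, R x s -> R x (set_var i v s)) ->
  (forall x s, R x s -> cells s 0 0 = n) ->
  (forall x (k : 'I_n), hoare (fun s => R x s /\ cells s 0 i = k) c
     (fun s => R (f x k) s /\ cells s 0 i = k)) ->
  hoare (R x) (For i c) (R (foldl f x (enum 'I_n))).
Proof.
move=> Ri Rn h.
pose pre k := foldl f x (take k (enum 'I_n)).
have -> : foldl f x (enum 'I_n) = pre n by rewrite /pre take_oversize ?size_enum_ord.
apply: (@hoare_for (fun k s => R (pre k) s)) => [s Rs | k lt_kn].
  by rewrite /pre take0; apply: Ri.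
apply: hoare_weaken (h (pre k) (Ordinal lt_kn)) => // s [Rs sk]; split=> //; first exact: Rn Rs.
apply: Ri; rewrite /pre (take_nth (Ordinal lt_kn)) ?size_enum_ord // foldl_rcons.
by have -> : nth (Ordinal lt_kn) (enum 'I_n) k = Ordinal lt_kn by apply: (nth_ord_enum _ (Ordinal lt_kn)).
Qed.

End Hoare.

Lemma halted_iter P s t t' : t <= t' -> halted P (iter t (step P) s) ->
  iter t' (step P) s = iter t (step P) s.
Proof.
move=> /subnK <- ht; elim: (t' - t) => //= k ->.
by rewrite /step; move: ht; rewrite /halted => /onth_default->.
Qed.

Lemma hoare_outputs n c x y : hoare n (fun s => s = AState (fun _ _ => 0) x [::]) c
    (fun s => out s = y) ->
  outputs (compile 0 c) x y /\ halted (compile 0 c) (run (compile 0 c) x (cost n c)).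
Proof.
move=> h; have at0 : code_at (compile 0 c) 0 (compile 0 c) by exists [::], [::]; rewrite cats0.
have [t [X' [s' [le_t e _ sy]]]] := h _ _ (AState (fun _ _ => 0) x [::]) (fun=> 0) at0 (fun _ _ _ _ => erefl) erefl.
have ht : halted (compile 0 c) (run (compile 0 c) x t).
  by rewrite /run /init e /halted /= size_compile.
split; first by exists t; split=> //; rewrite /run /init e.
by rewrite /run (halted_iter le_t).
Qed.

(** Since [n < size x], a bound polynomial in [n.+1] is one in the input size. *)
Lemma hoare_polynomial_time c (I : seq nat -> Prop) :
  (forall x, I x -> exists n y, n < size x /\
     hoare n (fun s => s = AState (fun _ _ => 0) x [::]) c (fun s => out s = y)) ->
  polynomial_time (compile 0 c) I.
Proof.
move=> h; have [C [d le_cost]] := cost_polynomial c.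
exists C, d => x /h[n [y [lt_n /hoare_outputs[_ halt_x]]]].
rewrite /run (halted_iter _ halt_x) //; apply: leq_trans (le_cost n) _.
apply: leq_trans (leq_addr _ _); rewrite leq_mul2l; apply/orP; right.
by case: d {le_cost} => // d; rewrite leq_exp2r.
Qed.

(** * The program *)

Module Layout.
Notation N := 0 (only parsing).
Notation ONE := 1 (only parsing).
Notation K := 2 (only parsing).
Notation V := 3 (only parsing).
Notation U := 4 (only parsing).
Notation CNT := 5 (only parsing).
Notation TMP := 6 (only parsing).
Notation PTR := 7 (only parsing).
Notation POS := 8 (only parsing).
Notation A := 9 (only parsing).
Notation B := 10 (only parsing).
Notation X := 11 (only parsing).
Notation Y := 12 (only parsing).
Notation Z := 13 (only parsing).
Notation X1 := 14 (only parsing).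
Notation Y1 := 15 (only parsing).
Notation Z1 := 16 (only parsing).
Notation AUX := 17 (only parsing).
(* Array numbers from here on, variable numbers above. *)
Notation ROW := 2 (only parsing).
(* Entry u n + v is 0 if v is u or a neighbour of u, and 1 otherwise. *)
Notation NADJ := 3 (only parsing).
Notation DOM := 4 (only parsing).
Notation SEL := 5 (only parsing).
Notation OUT := 6 (only parsing).
End Layout.

Section Program.
Import Layout.

(** Row offsets are tabulated because the machine cannot multiply. The two truncated differences of
    [U] and [V] add up to their distance, and subtracting it from 1 gives the bit telling whether
    they are equal. *)
Definition read_cmd : cmd :=
  Seq (Do [:: ORead N; OConst ONE 1; OConst POS 0])
  (For U (Seq (Do [:: OPut ROW U POS])
    (For V (Do [:: ORead TMP; OSub TMP ONE TMP;
      OSub AUX U V; OSub CNT V U; OAdd AUX AUX CNT; OSub AUX ONE AUX;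
      OSub TMP TMP AUX; OPut NADJ POS TMP; OAdd POS POS ONE])))).

Definition count_cmd : cmd :=
  Seq (Do [:: OConst CNT 0; OGet PTR ROW V])
  (For U (Do [:: OAdd POS PTR U; OGet TMP NADJ POS; OGet AUX DOM U;
    OAdd TMP TMP AUX; OSub TMP ONE TMP; OAdd CNT CNT TMP])).

(** [PTR] still holds the row offset of [V] computed by [count_cmd]. The new bit [1 - (NADJ - DOM)]
    is the disjunction of adjacency and old domination. *)
Definition select_cmd : cmd :=
  Seq (Do [:: OPut SEL V ONE])
  (For U (Do [:: OAdd POS PTR U; OGet TMP NADJ POS; OGet AUX DOM U;
    OSub TMP TMP AUX; OSub TMP ONE TMP; OPut DOM U TMP])).

(** The truncated difference [N - (CNT + K)] vanishes exactly when the gain reaches the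
    threshold. *)
Definition greedy_cmd : cmd :=
  For K (For V (Seq count_cmd
    (Seq (Do [:: OAdd CNT CNT K; OSub TMP N CNT]) (Unless TMP select_cmd)))).

(** [TMP] accumulates non-adjacency bits, so it stays 0 as long as every pair checked is adjacent or
    equal. *)
Definition check_cmd u v : cmd :=
  Do [:: OGet PTR ROW u; OAdd PTR PTR v; OGet AUX NADJ PTR; OAdd TMP TMP AUX].

Definition joiner_cmd : cmd :=
  Seq (Do [:: OMov X1 A; OMov Y1 A; OMov Z1 A])
  (For X (For Y (For Z (Seq (Do [:: OConst TMP 0])
    (Seq (check_cmd A X) (Seq (check_cmd X Y) (Seq (check_cmd Y Z) (Seq (check_cmd Z B)
    (Unless TMP (Do [:: OMov X1 X; OMov Y1 Y; OMov Z1 Z])))))))))).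

Definition if_selected i (c : cmd) : cmd :=
  Seq (Do [:: OGet TMP SEL i; OSub TMP ONE TMP]) (Unless TMP c).

Definition join_cmd : cmd :=
  For A (if_selected A (For B (if_selected B (Seq joiner_cmd
    (Do [:: OPut OUT A ONE; OPut OUT X1 ONE; OPut OUT Y1 ONE; OPut OUT Z1 ONE]))))).

Definition print_cmd : cmd :=
  For V (Seq (Do [:: OGet TMP OUT V; OSub TMP ONE TMP]) (Unless TMP (Do [:: OPrint V]))).

Definition approx_cmd : cmd := Seq read_cmd (Seq greedy_cmd (Seq join_cmd print_cmd)).

End Program.

(** * Correctness of the program *)

Lemma nth_allpairs (S T U : Type) (f : S -> T -> U) s t x0 y0 z0 i j :
  i < size s -> j < size t ->
  nth z0 [seq f x y | x <- s, y <- t] (i * size t + j) = f (nth x0 s i) (nth y0 t j).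
Proof.
elim: s i => // x s IHs [|i] lt_i lt_j; rewrite allpairs_cons nth_cat size_map.
  by rewrite lt_j (nth_map y0).
by rewrite mulSn -addnA ltnNge leq_addr addKn IHs.
Qed.

Lemma foldl_addn_count (T : Type) (p : pred T) s m :
  foldl (fun c x => c + p x) m s = m + count p s.
Proof. by elim: s m => [|x s IHs] m /=; rewrite ?addn0 // IHs addnA. Qed.

Lemma foldl_rcons_filter (T U : Type) (p : pred T) (g : T -> U) s ys :
  foldl (fun ys x => if p x then rcons ys (g x) else ys) ys s = ys ++ map g (filter p s).
Proof.
elim: s ys => [|x s IHs] ys /=; first by rewrite cats0.
by rewrite IHs; case: (p x); rewrite //= cat_rcons.
Qed.

Section Correctness.
Import Layout.
Variables (n : nat) (G : sgraph 'I_n).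
Hypothesis n_gt0 : 0 < n.
Implicit Types (u v : 'I_n) (S D : {set 'I_n}) (s : astate) (m : nat -> nat -> nat).

Definition graph_state s : Prop :=
  [/\ cells s 0 N = n, cells s 0 ONE = 1, forall u, cells s ROW u = u * n
    & forall u v, cells s NADJ (u * n + v) = ~~ cadj G u v].

(** By uniqueness of Euclidean division, writing one matrix entry leaves the others unchanged. *)
Lemma index_inj (u1 u2 v1 v2 : nat) : v1 < n -> v2 < n ->
  u1 * n + v1 = u2 * n + v2 -> u1 = u2 /\ v1 = v2.
Proof.
move=> lt_v1 lt_v2 e; have := edivn_eq u1 lt_v1; rewrite e edivn_eq //.
by case.
Qed.

Lemma hoare_read :
  hoare n (fun s => s = AState (fun _ _ => 0) (encode_graph G) [::]) read_cmd
    (fun s => [/\ graph_state s, out s = [::] & forall a j, cells s a.+4 j = 0]).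
Proof.
set bits := behead (encode_graph G).
have nth_bits u v : nth 0 bits (u * n + v) = G u v.
  have := @nth_allpairs _ _ _ (fun u v => nat_of_bool (G u v)) (enum 'I_n) (enum 'I_n) u v 0 u v.
  by rewrite !size_enum_ord !nth_ord_enum; apply.
pose base s := [/\ cells s 0 N = n, cells s 0 ONE = 1, out s = [::] & forall a j, cells s a.+4 j = 0].
(* The first [q] bits have been consumed and their entries filled in; [q] is [k * n + c] at column
   [c] of row [k]. *)
pose upto q s := [/\ cells s 0 POS = q, inp s = drop q bits
  & forall u v, u * n + v < q -> cells s NADJ (u * n + v) = ~~ cadj G u v].
pose rows k s := forall u, u < k -> cells s ROW u = u * n.
apply: (@hoare_seq _ (fun s => [/\ base s, upto 0 s & rows 0 s])).
  apply: hoare_do => // _ ->; split=> //=; split=> //; last by rewrite /= drop0.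
apply: (hoare_weaken (B' := fun s => [/\ base s, upto (n * n) s & rows n s])
  (A' := fun s => [/\ base s, upto 0 s & rows 0 s])) => //.
  move=> s [[s1 s2 s3 s4] [p1 p2 p3] r]; split=> //; split=> // [u | u v]; first exact: r.
  by apply: p3; have := ltn_ord u; have := ltn_ord v; nia.
apply: (hoare_for n_gt0 (I := fun k s => [/\ base s, upto (k * n) s & rows k s])).
  by move=> [m x y] [[s1 s2 s3 s4] [p1 p2 p3] r]; rewrite mul0n.
move=> k lt_kn.
apply: (@hoare_seq _ (fun s => [/\ base s, upto (k * n + 0) s, rows k.+1 s & cells s 0 U = k])).
  apply: hoare_do => // -[m x y] [[[s1 s2 s3 s4] [p1 p2 p3] r] uk]; rewrite addn0.
  rewrite /= in s1 s2 s3 s4 p1 p2 p3 r uk *.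
  split=> // u; rewrite ltnS leq_eqVlt /set_cell /= uk p1; case: eqP => [-> // | _] /=.
  exact: r.
apply: (hoare_weaken (A' := fun s => [/\ base s, upto (k * n + 0) s, rows k.+1 s & cells s 0 U = k])
  (B' := fun s => [/\ base s, upto (k * n + n) s, rows k.+1 s & cells s 0 U = k])) => //.
  by move=> [m x y] [[s1 s2 s3 s4] [p1 p2 p3] r uk]; rewrite mulSn addnC.
apply: (hoare_for n_gt0 (I := fun c s => [/\ base s, upto (k * n + c) s, rows k.+1 s & cells s 0 U = k])).
  by move=> [m x y] [[s1 s2 s3 s4] [p1 p2 p3] r uk].
move=> c lt_cn; apply: hoare_do => // -[m x y] [[[s1 s2 s3 s4] [p1 p2 p3] r uk] vc].
rewrite /= in s1 s2 s3 s4 p1 p2 p3 r uk vc.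
pose u := Ordinal lt_kn; pose v := Ordinal lt_cn.
have x_head : head 0 x = G u v by rewrite p2 -nth0 nth_drop addn0 -(nth_bits u v).
split=> //; split=> //; split.
- by rewrite /= /set_cell /= p1 s2 addn1 addnS.
- by rewrite /= p2 -drop1 drop_drop addnC addn1 addnS.
- move=> u1 v1; rewrite addnS ltnS leq_eqVlt /= /set_cell /= p1 s2 uk vc x_head.
  case: eqP => [/(index_inj (ltn_ord v1) lt_cn)[e1 e2] _ | _ /= ]; last exact: p3.
  have [-> ->] : u1 = u /\ v1 = v by split; apply: val_inj.
  rewrite /cadj -val_eqE /= ; case: (G u v); rewrite ?orbT //=.
  by case: ltngtP => [lt|lt|->] /=; lia.
Qed.

Definition greedy_state S s : Prop :=
  [/\ graph_state s, out s = [::], forall u, cells s DOM u = dominated G S u,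
    forall u, cells s SEL u = (u \in S) & forall j, cells s OUT j = 0].

Lemma hoare_count k S v :
  hoare n (fun s => [/\ greedy_state S s, cells s 0 K = k & cells s 0 V = v]) count_cmd
    (fun s => [/\ greedy_state S s, cells s 0 K = k, cells s 0 V = v,
      cells s 0 PTR = v * n & cells s 0 CNT = gain G S v]).
Proof.
pose R c s := [/\ greedy_state S s, cells s 0 K = k, cells s 0 V = v,
      cells s 0 PTR = v * n & cells s 0 CNT = c].
apply: (@hoare_seq _ (R 0)).
  apply: hoare_do => // -[m x y] [[[s1 s2 s3 s4] s5 s6 s7 s8] sk sv].
  rewrite /= in s1 s2 s3 s4 s5 s6 s7 s8 sk sv.
  by split=> //; rewrite /= /set_cell /= sv s3.
have -> : gain G S v = foldl (fun c u => c + (cadj G v u && ~~ dominated G S u)) 0 (enum 'I_n).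
  rewrite foldl_addn_count add0n /gain -count_enum_mem; apply: eq_count => u.
  by rewrite /= inE.
apply: (hoare_for_foldl n_gt0 (R := R)) => [c w [m x y]|c s|c u].
- by move=> [[[s1 s2 s3 s4] s5 s6 s7 s8] sk sv sp sc]; split.
- by case=> [[[]]].
apply: hoare_do => // -[m x y] [[[[s1 s2 s3 s4] s5 s6 s7 s8] sk sv sp sc] su].
rewrite /= in s1 s2 s3 s4 s5 s6 s7 s8 sk sv sp sc su.
split=> //; split=> //; rewrite /= /set_cell /= sc sp su s2 s4 s6.
by case: cadj; case: dominated.
Qed.

Lemma hoare_select k S v :
  hoare n (fun s => [/\ greedy_state S s, cells s 0 K = k, cells s 0 V = v & cells s 0 PTR = v * n])
    select_cmd
    (fun s => [/\ greedy_state (v |: S) s, cells s 0 K = k & cells s 0 V = v]).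
Proof.
(* [DOM] is updated in place: after [c] iterations the entries below [c] refer to [v |: S], the
   others still to [S]. *)
pose R c s := [/\ [/\ graph_state s, out s = [::],
    forall u, cells s DOM u = dominated G S u || (u < c) && cadj G v u,
    forall u, cells s SEL u = (u \in v |: S) & forall j, cells s OUT j = 0],
   cells s 0 K = k, cells s 0 V = v & cells s 0 PTR = v * n].
apply: (@hoare_seq _ (R 0)).
  apply: hoare_do => // -[m x y] [[[s1 s2 s3 s4] s5 s6 s7 s8] sk sv sp].
  rewrite /= in s1 s2 s3 s4 s5 s6 s7 s8 sk sv sp.
  split=> //; split=> // u; first by rewrite /= /set_cell /= s6 orbF.
  by rewrite /= /set_cell /= sv s2 s7 !inE val_eqE; case: eqP.
apply: (hoare_weaken (A' := R 0) (B' := R n)) => //.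
  move=> s [[s1 s2 s3 s4 s5] sk sv sp]; split=> //; split=> // u.
  by rewrite dominatedU1 s3 ltn_ord orbC.
apply: (hoare_for n_gt0).
  by move=> [m x y] [[[s1 s2 s3 s4] s5 s6 s7 s8] sk sv sp].
move=> c lt_cn; apply: hoare_do => // -[m x y] [[[[s1 s2 s3 s4] s5 s6 s7 s8] sk sv sp] su].
rewrite /= in s1 s2 s3 s4 s5 s6 s7 s8 sk sv sp su.
split=> //; split=> //; split=> // u.
rewrite /= /set_cell /= su sp s2 ltnS leq_eqVlt.
case: eqP => [uc | _] /=; last exact: s6.
by rewrite -uc s4 s6 -uc ltnn /= orbF; case: cadj; case: dominated.
Qed.

Lemma hoare_greedy : hoare n (greedy_state set0) greedy_cmd (greedy_state (greedy G)).
Proof.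
have RN S s : greedy_state S s -> cells s 0 N = n by case=> [[]].
apply: (hoare_for_foldl n_gt0 (R := greedy_state)) => [S w [m x y]|S s|S k].
- by case=> [[]].
- exact: RN.
apply: (hoare_for_foldl n_gt0 (R := fun S s => greedy_state S s /\ cells s 0 K = k)).
- by move=> {}S w [m x y] [[[]]].
- by move=> {}S s [/RN].
move=> {}S v.
apply: (hoare_seq (B := fun s => [/\ greedy_state S s, cells s 0 K = k, cells s 0 V = v,
      cells s 0 PTR = v * n & cells s 0 CNT = gain G S v])).
  by apply: (hoare_weaken _ _ (@hoare_count k S v)) => // s [[]].
apply: (hoare_seq (B := fun s => [/\ greedy_state S s, cells s 0 K = k, cells s 0 V = v,
      cells s 0 PTR = v * n & cells s 0 TMP = n - (gain G S v + k)])).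
  apply: hoare_do => // -[m x y] [[[s1 s2 s3 s4] s5 s6 s7 s8] sk sv sp sc].
  rewrite /= in s1 s2 s3 s4 s5 s6 s7 s8 sk sv sp sc.
  by split=> //; rewrite /= /set_cell /= s1 sc sk.
apply: hoare_unless => [s [Ss sk sv _ ->] | ].
  by rewrite subn_gt0 ltnNge /greedy_step => /negbTE->.
(* If the gain is too small, [TMP] is positive and the precondition of the guarded body is
   contradictory. *)
have [le_n | lt_n] := leqP n (gain G S v + k); last first.
  by move=> P l s X _ _ [[_ _ _ _ ->]] /eqP; rewrite subn_eq0 leqNgt lt_n.
rewrite /greedy_step le_n; apply: (hoare_weaken _ _ (@hoare_select k S v)) => s; first by case=> [[]].
by case.
Qed.

Definition join_state S D s : Prop :=
  [/\ graph_state s, out s = [::], forall u, cells s SEL u = (u \in S)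
    & forall u, cells s OUT u = (u \in D)].

Lemma hoare_joiner S D (a b : 'I_n) :
  hoare n (fun s => [/\ join_state S D s, cells s 0 A = a & cells s 0 B = b]) joiner_cmd
    (fun s => [/\ join_state S D s, cells s 0 A = a, cells s 0 B = b &
      [/\ cells s 0 X1 = (joiner G a b).1.1, cells s 0 Y1 = (joiner G a b).1.2
        & cells s 0 Z1 = (joiner G a b).2]]).
Proof.
pose R (t : 'I_n * 'I_n * 'I_n) s := [/\ join_state S D s, cells s 0 A = a, cells s 0 B = b &
  [/\ cells s 0 X1 = t.1.1, cells s 0 Y1 = t.1.2 & cells s 0 Z1 = t.2]].
have RN t s : R t s -> cells s 0 N = n by case=> [[[]]].
apply: (@hoare_seq _ (R (a, a, a))).
  apply: hoare_do => // -[m x y] [[[s1 s2 s3 s4] s5 s6 s7] sa sb].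
  by rewrite /= in s1 s2 s3 s4 s5 s6 s7 sa sb.
apply: (hoare_for_foldl n_gt0 (R := R)) => [t w [m x y]|t s|t x].
- by move=> [[[s1 s2 s3 s4] s5 s6 s7] sa sb []].
- exact: RN.
apply: (hoare_for_foldl n_gt0 (R := fun t s => R t s /\ cells s 0 X = x))
  => [{}t w [m xs ys]|{}t s|{}t y].
- by move=> [[[[s1 s2 s3 s4] s5 s6 s7] sa sb []]].
- by case=> /RN.
apply: (hoare_weaken (A' := fun s => [/\ R t s, cells s 0 X = x & cells s 0 Y = y])
  (B' := fun s => [/\
    R (foldl (fun t z => if joins G a b (x, y, z) then (x, y, z) else t) t (enum 'I_n)) s,
    cells s 0 X = x & cells s 0 Y = y])).
- by move=> s [[]].
- by move=> s [].
apply: (hoare_for_foldl n_gt0 (R := fun t s => [/\ R t s, cells s 0 X = x & cells s 0 Y = y]))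
  => [{}t w [m xs ys]|{}t s|{}t z].
- by move=> [[[[s1 s2 s3 s4] s5 s6 s7] sa sb []]].
- by case=> /RN.
(* [p] records whether all pairs checked so far are adjacent or equal. *)
pose Q p s := [/\ R t s, cells s 0 X = x, cells s 0 Y = y, cells s 0 Z = z &
  (cells s 0 TMP == 0) = p].
(* [check_cmd] overwrites [PTR] before reading variable [j], so [j] must differ from it. *)
have check p i j (u v : 'I_n) : (j == PTR) = false ->
    (forall p s, Q p s -> cells s 0 i = u /\ cells s 0 j = v) ->
    hoare n (Q p) (check_cmd i j) (Q (p && cadj G u v)).
  move=> j7 Qij; apply: hoare_do => // -[m xs ys] Qs; have [si sj] := Qij _ _ Qs.
  case: Qs => [[[[s1 s2 s3 s4] s5 s6 s7] sa sb [s8 s9 s10]] sx sy sz sp].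
  rewrite /= in s1 s2 s3 s4 s5 s6 s7 s8 s9 s10 sa sb sx sy sz sp si sj.
  split=> //; rewrite /= /set_cell /= j7 si sj s3 s4 addn_eq0 sp.
  by case: cadj.
apply: (@hoare_seq _ (Q true)).
  apply: hoare_do => // -[m xs ys] [[[[[s1 s2 s3 s4] s5 s6 s7] sa sb [s8 s9 s10]] sx sy] sz].
  by rewrite /= in s1 s2 s3 s4 s5 s6 s7 s8 s9 s10 sa sb sx sy sz.
apply: hoare_seq (@check _ A X a x erefl _) _; first by move=> p s [[]].
apply: hoare_seq (@check _ X Y x y erefl _) _; first by move=> p s [[]].
apply: hoare_seq (@check _ Y Z y z erefl _) _; first by move=> p s [[]].
apply: hoare_seq (@check _ Z B z b erefl _) _; first by move=> p s [[]].
have -> : [&& [&& [&& true && cadj G a x & cadj G x y] & cadj G y z] & cadj G z b] = joins G a b (x, y, z).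
  by rewrite /joins /= andbT !andbA.
apply: hoare_unless => [s [Rs sx sy sz <-] | ]; first by rewrite lt0n => /negbTE->.
case: joins; last by move=> P l s X _ _ [[_ _ _ _ /eqP]].
apply: hoare_do => // -[m xs ys] [[[[[s1 s2 s3 s4] s5 s6 s7] sa sb _] sx sy sz _] _].
by rewrite /= in s1 s2 s3 s4 s5 s6 s7 sa sb sx sy sz.
Qed.

Lemma hoare_join S : hoare n (join_state S set0) join_cmd (join_state S (join_all G S)).
Proof.
have RN D s : join_state S D s -> cells s 0 N = n by case=> [[]].
apply: (hoare_for_foldl n_gt0 (R := join_state S)) => [D w [m x y]|D s|D a].
- by case=> [[]].
- exact: RN.
apply: (hoare_seq (B := fun s => [/\ join_state S D s, cells s 0 A = a &
    (cells s 0 TMP == 0) = (a \in S)])).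
  apply: hoare_do => // -[m xs ys] [[[s1 s2 s3 s4] s5 s6 s7] sa].
  rewrite /= in s1 s2 s3 s4 s5 s6 s7 sa.
  by split=> //; rewrite /= /set_cell /= sa s2 s6; case: (a \in S).
apply: hoare_unless => [s [Rs sa <-] | ]; first by rewrite lt0n => /negbTE->.
have [Sa | nSa] := boolP (a \in S); last by move=> P l s X _ _ [[_ _ /eqP]].
apply: (hoare_weaken (A' := fun s => join_state S D s /\ cells s 0 A = a)
  (B' := fun s => join_state S
    (foldl (fun D b => if b \in S then add_joiner G a D b else D) D (enum 'I_n)) s /\
    cells s 0 A = a)) => //.
  by move=> s [[]].
apply: (hoare_for_foldl n_gt0 (R := fun D s => join_state S D s /\ cells s 0 A = a))
  => [{}D w [m x y]|{}D s|{}D b].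
- by case=> [[[]]].
- by case=> /RN.
apply: (hoare_seq (B := fun s => [/\ join_state S D s, cells s 0 A = a, cells s 0 B = b &
    (cells s 0 TMP == 0) = (b \in S)])).
  apply: hoare_do => // -[m xs ys] [[[[s1 s2 s3 s4] s5 s6 s7] sa] sb].
  rewrite /= in s1 s2 s3 s4 s5 s6 s7 sa sb.
  by split=> //; rewrite /= /set_cell /= sb s2 s6; case: (b \in S).
apply: hoare_unless => [s [Rs sa sb <-] | ]; first by rewrite lt0n => /negbTE->.
have [Sb | nSb] := boolP (b \in S); last by move=> P l s X _ _ [[_ _ _ /eqP]].
apply: hoare_seq (hoare_weaken _ (fun _ => id) (@hoare_joiner S D a b)) _; first by move=> s [[]].
apply: hoare_do => // -[m xs ys] [[[s1 s2 s3 s4] s5 s6 s7] sa sb [s8 s9 s10]].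
rewrite /= in s1 s2 s3 s4 s5 s6 s7 sa sb s8 s9 s10.
split=> //; split=> //; split=> // u.
rewrite /= /set_cell /= sa s8 s9 s10 s2 s7 /add_joiner.
case: (joiner G a b) => [[x y] z] /=; rewrite !inE -!val_eqE /=.
by do 4 case: (_ == _).
Qed.

Lemma hoare_print S D : hoare n (join_state S D) print_cmd (fun s => out s = encode_set D).
Proof.
pose R ys s := [/\ cells s 0 N = n, cells s 0 ONE = 1, forall u, cells s OUT u = (u \in D) & out s = ys].
pose f (ys : seq nat) (v : 'I_n) := if v \in D then rcons ys (val v) else ys.
(* [enum D] filters the enumeration of ['I_n], so the printing loop meets its elements in the same
   order. *)
have -> : encode_set D = foldl f [::] (enum 'I_n).
  by rewrite foldl_rcons_filter /encode_set enumT.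
apply: (hoare_weaken (A' := R [::]) (B' := R (foldl f [::] (enum 'I_n)))) => [s|s|].
- by case=> [[]].
- by case.
apply: (hoare_for_foldl n_gt0 (R := R)) => [ys w [m x y]|ys s|ys v].
- by case.
- by case.
apply: (hoare_seq (B := fun s => [/\ R ys s, cells s 0 V = v & (cells s 0 TMP == 0) = (v \in D)])).
  apply: hoare_do => // -[m x y] [[s1 s2 s3 s4] sv].
  rewrite /= in s1 s2 s3 s4 sv.
  by split=> //; rewrite /= /set_cell /= sv s2 s3; case: (v \in D).
apply: hoare_unless => [s [Rs sv tD] | ]; first by rewrite lt0n tD /f => /negbTE->.
rewrite /f; case: (v \in D); last by move=> P l s X _ _ [[_ _ /eqP]].
apply: hoare_do => // -[m x y] [[[s1 s2 s3 s4] sv _] _].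
by rewrite /= in s1 s2 s3 s4 sv; split=> //; split=> //; rewrite /= sv s4.
Qed.

Lemma hoare_approx :
  hoare n (fun s => s = AState (fun _ _ => 0) (encode_graph G) [::]) approx_cmd
    (fun s => out s = encode_set (approx_solution G)).
Proof.
(* [DOM], [SEL] and [OUT] are arrays 4 to 6, still zero after reading, and thus encode the empty
   set. *)
have greedy0 s : [/\ graph_state s, out s = [::] & forall a j, cells s a.+4 j = 0] ->
    greedy_state set0 s.
  move=> [s1 s2 s3]; split=> // [u | u]; rewrite s3 ?inE //.
  by rewrite /dominated; case: existsP => // -[a]; rewrite inE.
have join0 s : greedy_state (greedy G) s -> join_state (greedy G) set0 s.
  by case=> s1 s2 s3 s4 s5; split=> // u; rewrite s5 inE.
apply: hoare_seq hoare_read _.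
apply: hoare_seq (hoare_weaken greedy0 join0 hoare_greedy) _.
exact: hoare_seq (@hoare_join _) (@hoare_print _ _).
Qed.

End Correctness.

Lemma polynomial_time_approx : polynomial_time (compile 0 approx_cmd) is_instance.
Proof.
apply: hoare_polynomial_time => _ [n [G [[n_gt0 _] ->]]]; rewrite card_ord in n_gt0.
exists n, (encode_set (approx_solution G)); split; last exact: hoare_approx.
(* The input consists of [n * n + 1] numbers, more than [n] because [n] is positive. *)
by rewrite /= size_allpairs size_enum_ord ltnS leq_pmulr.
Qed.

(** * The approximation ratio *)

From mathcomp Require Import all_classical all_reals all_analysis.
Import numFieldNormedType.Exports.
Local Open Scope ring_scope.
Local Open Scope classical_set_scope.

(** By induction: the new term [1 / n.+2] is at most [ln n.+2 - ln n.+1], which is [ln (1 + x) <= x]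
    at [x = - 1 / n.+2]. *)
Lemma harmonic_sum_ln (R : realType) n : (0 < n)%N -> harmonic_sum R n <= 1 + ln n%:R.
Proof.
case: n => // n _; elim: n => [|n IHn].
  by rewrite /harmonic_sum big_ord1 invr1 ln1 addr0.
rewrite /harmonic_sum big_ord_recr /= -/(harmonic_sum R n.+1).
apply: (le_trans (lerD IHn (lexx _))); rewrite -addrA lerD2l -lerBrDl.
have n2 : 0 < n.+2%:R :> R by rewrite ltr0n.
have e : n.+1%:R / n.+2%:R = 1 + - n.+2%:R^-1 :> R.
  have n2_neq0 := lt0r_neq0 n2; apply: (mulIf n2_neq0).
  by rewrite divfK // mulrDl mulNr mulVf // mul1r -[n.+2%:R]natr1 addrK.
rewrite -lerN2 opprB -ln_div ?posrE ?ltr0n // e le_ln1Dx //.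
by rewrite ltrN2 invf_lt1 // ltr1n.
Qed.

Lemma card_approx (R : realType) n (G : sgraph 'I_n) alpha : (0 < n)%N -> (0 < alpha)%N ->
  #|approx_solution G|%:R <= 2 * Num.sqrt n%:R * (1 + ln n%:R) * (optimum G alpha)%:R :> R.
Proof.
move=> n_gt0 alpha_gt0; have [D domD <-] := optimum_dominating G alpha_gt0.
have ln_ge0 : 0 <= 1 + ln n%:R :> R by rewrite addr_ge0 // ln_ge0 // ler1n.
have le_S : #|greedy G|%:R <= (1 + ln n%:R) * #|D|%:R :> R.
  by rewrite mulrC (le_trans (card_greedy R domD)) // ler_wpM2l // harmonic_sum_ln.
rewrite -mulrA; apply: le_trans (ler_wpM2l _ le_S); last by rewrite mulr_ge0 ?sqrtr_ge0.
(* After squaring, the claim concerns natural numbers: [d <= n] and [d <= 4 * g ^ 2] multiply to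
   [d ^ 2 <= 4 * n * g ^ 2]. *)
rewrite -(@ler_pXn2r _ 2) ?nnegrE ?mulr_ge0 ?sqrtr_ge0 //.
rewrite !exprMn sqr_sqrtr // -!natrX -!natrM ler_nat.
have := card_join_all G (greedy G); have := max_card (approx_solution G).
by rewrite card_ord -/(approx_solution G); move: #|_| => d; move: #|_| => g; nia.
Qed.

Theorem theorem3 (R : realType) (alpha : nat) (halpha : (5 <= alpha)%N) :
  exists (P : program) (r : nat -> R),
    [/\ polynomial_time P is_instance,
        approximation_algorithm alpha r P &
        r =O_\oo (fun n : nat => Num.sqrt n%:R * ln n%:R)].
Proof.
exists (compile 0 approx_cmd), (fun n => 2 * Num.sqrt n%:R * (1 + ln n%:R)); split.
- exact: polynomial_time_approx.
- move=> n G [n_gt0 _]; rewrite card_ord in n_gt0; exists (approx_solution G); split.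
  + by have [] := hoare_outputs (@hoare_approx n G n_gt0).
  + exact: feasible_approx.
  + by apply: card_approx => //; apply: leq_trans halpha.
(* Once [n] is at least [expR 1], its logarithm [l] is at least 1, so
   [2 * s * (1 + l) <= 4 * (s * l)] with [s] the square root; any constant [k >= 4] works. *)
apply/eqOP; near=> k; near=> n.
have ln_ge1 : 1 <= ln n%:R :> R.
  have n_ge : expR 1 <= n%:R :> R by near: n; apply: nbhs_infty_ger.
  by rewrite -[leLHS]expRK ler_ln // ?posrE ?expR_gt0 // (lt_le_trans (expR_gt0 1)).
have k4 : 4 <= k by near: k; apply: nbhs_pinfty_ge; rewrite num_real.
have s_ge0 : 0 <= Num.sqrt (n%:R : R) by rewrite sqrtr_ge0.
rewrite !ger0_norm ?mulr_ge0 ?addr_ge0 // ?(le_trans ler01) //.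
move: (Num.sqrt _) (ln _) ln_ge1 s_ge0 => s l l1 s0.
have sl : 0 <= s * l by rewrite mulr_ge0 // (le_trans ler01).
have : s <= s * l by rewrite ler_peMr.
by have : 4 * (s * l) <= k * (s * l) by [rewrite ler_wpM2r|]; nra.
Unshelve. all: by end_near. Qed.
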